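(* Let $G$ be a chain graph on a finite vertex set $V$ and $\mathcal{H}$ its canonical LWF DAH. Then a probability measure $P$ on $\mathcal{X}=\times_{v\in V}\mathcal{X}_v$ with density $f$ (with respect to a product measure $\mu=\times_v\mu_v$) factorizes according to $G$ if and only if $f$ factorizes according to $\mathcal{H}$.
   Context: Chain graph $G$: edges undirected ($u-w$) or directed ($u\to w$), no partially directed cycle (cycle of distinct vertices, steps along undirected edges or directed edges forwards, at least one directed step). $pa(v)=\{u:u\to v\}$, $nb(v)=\{u:u-v\}$; chain components are connected components of the undirected edges; $pa(\tau)=\bigcup_{v\in\tau}pa(v)\setminus\tau$, $bd(\tau)=\bigcup_{v\in\tau}(pa(v)\cup nb(v))\setminus\tau$, $cl(\tau)=bd(\tau)\cup\tau$; $G_S$ induced subgraph; moral graph $K^m$ of a chain graph $K$: undirected graph where $u,w$ adjacent iff adjacent in $K$ or both in $bd(\tau)$ for a chain component $\tau$ of $K$. $P$ factorizes according to $G$ if $f(x)=\prod_\tau f(x_\tau\mid x_{pa(\tau)})$ over chain components and for each $\tau$, $f(x_\tau\mid x_{pa(\tau)})=Z^{-1}(x_{pa(\tau)})\prod_{h\in\mathcal{C}}\psi_h(x)$, $\mathcal{C}$ the maximal cliques of $(G_{\tau\cup pa(\tau)})^m$, $\psi_h\ge0$ depending only on $x_h$, and $Z(x_{pa(\tau)})=\int_{\mathcal{X}_\tau}\prod_{h\in\mathcal{C}}\psi_h\,d\mu_\tau$ the normalizer. Directed hypergraph: hyperedges $h=(T(h),H(h))$ with disjoint, possibly empty $T(h),H(h)\subseteq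 V$; $u$ parent of $v$ if $u\in T(h),v\in H(h)$ for some $h$; $u,v$ co-head if $\{u,v\}\subseteq H(h)$ for some $h$. Chain components of a DAH: classes of the transitive-reflexive closure of co-head; $\mathcal{H}_S$: hyperedges with $T(h)\cup H(h)\subseteq S$. $\mathcal{M}(\mathcal{F})$: inclusion-maximal sets among $\{T(h)\cup H(h):h\in\mathcal{F}\}$. $f$ factorizes according to $\mathcal{H}$ if $f(x)=\prod_\tau f(x_\tau\mid x_{pa(\tau)})$ over chain components of $\mathcal{H}$ and, with $\mathcal{H}^*_\tau$ the hyperedges $h$ of $\mathcal{H}_{\tau\cup pa(\tau)}$ with $H(h)\subseteq\tau$, $f(x_\tau\mid x_{pa(\tau)})=\prod_{h\in\mathcal{M}(\mathcal{H}^*_\tau)}\psi_h(x)$, $\psi_h\ge0$ depending only on $x_h$, integrating to $1$ over $\mathcal{X}_\tau$. Canonical LWF DAH of $G$: $V(\mathcal{H})=V$. Phase I: for each $v$, with $S_v$ its children and $G'$ the graph of undirected edges of $G$ within $S_v$, add $(\{v\},K)$ for each maximal clique $K$ of $G'$; with $\mathcal{H}'$ the result, add $(\emptyset,K)$ for each maximal clique $K$ of the undirected part of $G$ not contained in $H(h)$ for any $h\in\mathcal{H}'$. Phase II: with $\mathcal{H}'$ the Phase I hypergraph, for each chain component $\tau$ of $G$ let $\mathcal{H}'^*_\tau$ be the hyperedges $h$ of $\mathcal{H}'_{cl(\tau)}$ with $H(h)\cap\tau\neq\emptyset$; $E(\mathcal{H})=\bigcup_\tau\{(\bigcup_{h\in\mathcal{H}'^*_\tau,B\subseteq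 H(h)}T(h),B):B=\bigcap_{h\in\mathcal{F}}H(h),\mathcal{F}\subseteq\mathcal{H}'^*_\tau\}$.
   Formalization: In the factorization by 𝓗, the hyperedges in 𝓗*_τ are also required to satisfy T(h) ⊆ pa(τ); otherwise empty-head hyperedges from other components add interactions and the claim fails (a–c–b, d–f–e, a→d, b→e). In Phase II, 𝓕 is nonempty. *)

(* Defs.v *)
From HB Require Import structures.
From mathcomp Require Import all_boot.

Set Implicit Arguments.
Unset Strict Implicit.
Unset Printing Implicit Defensive.

Section Graphs.
Variable V : finType.

(* The vertex set is a field so that induced subgraphs live on the same type;
   [dir G u w] is u -> w. *)
Record mgraph := MGraph {
  verts : {set V};
  und : rel V;
  dir : rel V
}.

Implicit Types (G : mgraph) (u v w : V) (S tau K : {set V}).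

(* Read on a cyclic sequence, this covers cycles of length 1 and 2: it rules
   out directed loops, opposite arrows, and an arrow parallel to a line. *)
Definition no_partially_directed_cycle G : Prop :=
  forall c : seq V, uniq c -> cycle (fun u w => und G u w || dir G u w) c ->
    {in c, forall u, ~~ dir G u (next c u)}.

Definition is_chain_graph G : Prop :=
  [/\ forall u w, und G u w || dir G u w -> (u \in verts G) && (w \in verts G),
      symmetric (und G), irreflexive (und G) & no_partially_directed_cycle G].

Definition pa_v G v : {set V} := [set u | dir G u v].
Definition nb_v G v : {set V} := [set u | und G u v].
Definition ch_v G v : {set V} := [set w | dir G v w].

Definition gcomponents G : {set {set V}} :=
  [set [set u in verts G | connect (und G) v u] | v in verts G].

Definition gpa G tau : {set V} := (\bigcup_(v in tau) pa_v G v) :\: tau.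
Definition gbd G tau : {set V} :=
  (\bigcup_(v in tau) (pa_v G v :|: nb_v G v)) :\: tau.
Definition gcl G tau : {set V} := gbd G tau :|: tau.

Definition induced G S : mgraph :=
  MGraph (verts G :&: S)
    (fun u w => [&& u \in S, w \in S & und G u w])
    (fun u w => [&& u \in S, w \in S & dir G u w]).

Definition moral_adj G : rel V := fun u w =>
  [|| und G u w, dir G u w, dir G w u
    | [exists tau in gcomponents G, (u \in gbd G tau) && (w \in gbd G tau)]].

Definition clique S (e : rel V) K : bool :=
  (K \subset S) && [forall u in K, forall w in K, (u != w) ==> e u w].

Definition maxcliques S (e : rel V) : {set {set V}} :=
  [set K | maxset (clique S e) K].

Definition moral_cliques G tau : {set {set V}} :=
  let K := induced G (tau :|: gpa G tau) in maxcliques (verts K) (moral_adj K).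

(* A hyperedge h is the pair (T(h), H(h)). *)
Definition hyperedge := ({set V} * {set V})%type.
Definition etail (h : hyperedge) : {set V} := h.1.
Definition ehead (h : hyperedge) : {set V} := h.2.
Definition hypergraph := {set hyperedge}.

Implicit Types (E F : hypergraph) (h : hyperedge).

Definition hpa_v E v : {set V} :=
  [set u | [exists h in E, (u \in etail h) && (v \in ehead h)]].
Definition cohead E : rel V :=
  fun u v => [exists h in E, (u \in ehead h) && (v \in ehead h)].

(* [connect] is the reflexive-transitive closure; the vertex set is all of V. *)
Definition hcomponents E : {set {set V}} :=
  [set [set u | connect (cohead E) v u] | v : V].

Definition hpa E tau : {set V} := (\bigcup_(v in tau) hpa_v E v) :\: tau.

Definition hinduced E S : hypergraph :=
  [set h in E | etail h :|: ehead h \subset S].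

(* The hyperedges of E within tau and its parents that point into tau.  When
   ehead h is nonempty, etail h \subset hpa E tau follows from the other two
   conditions by acyclicity.  It matters only for hyperedges with empty head:
   such an h encodes a factor on parents alone, and it belongs to tau only if
   etail h consists of parents of tau.  Without it, ({a, b}, set0), created by
   the component {d, e, f} of a - c - b, d - f - e, a -> d, b -> e, would add
   an a,b-interaction to the component {a, b, c}. *)
Definition hstar E tau : hypergraph :=
  [set h in hinduced E (tau :|: hpa E tau)
     | (etail h \subset hpa E tau) && (ehead h \subset tau)].

Definition maxedges F : {set {set V}} :=
  [set A | maxset (fun B => B \in [set etail h :|: ehead h | h in F]) A].

Definition phaseI_children G : hypergraph :=
  \bigcup_(v in verts G)
     [set ([set v], K) | K in maxcliques (ch_v G v) (und G)].

Definition phaseI G : hypergraph :=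
  phaseI_children G :|:
  [set (set0, K) | K in maxcliques (verts G) (und G)
                 & [forall h in phaseI_children G, ~~ (K \subset ehead h)]].

Definition phaseI_star G tau : hypergraph :=
  [set h in hinduced (phaseI G) (gcl G tau) | ehead h :&: tau != set0].

(* Intersections are over nonempty subfamilies F; the resulting B may be
   empty, in which case the hyperedge is (pa(tau), set0). *)
Definition phaseII_heads G tau : {set {set V}} :=
  [set \bigcap_(h in F) ehead h
     | F : hypergraph in powerset (phaseI_star G tau) & F != set0].

Definition canonical_DAH G : hypergraph :=
  \bigcup_(tau in gcomponents G)
     [set (\bigcup_(h in phaseI_star G tau | B \subset ehead h) etail h, B)
        | B : {set V} in phaseII_heads G tau].

End Graphs.

From mathcomp Require Import all_order all_algebra.
From mathcomp Require Import all_classical all_reals all_analysis.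
Import Order.TTheory GRing.Theory Num.Theory.
Import numFieldNormedType.Exports.
Local Open Scope classical_set_scope.
Local Open Scope ring_scope.

Section ProductSpaces.
Variables (I : Type) (d : I -> measure_display).
Variable T : forall i, measurableType (d i).

Definition cylinders : set (set (forall i, T i)) :=
  [set C | exists i (A : set (T i)), measurable A /\ C = [set x | A (x i)]].

Definition prod_space := g_sigma_algebraType cylinders.

End ProductSpaces.

(* For sigma-finite mu_i this determines m uniquely. *)
Definition is_product_measure (R : realType) (I : finType)
    (d : I -> measure_display) (T : forall i, measurableType (d i))
    (mu_ : forall i, set (T i) -> \bar R) (m : set (prod_space T) -> \bar R) :=
  forall A : (forall i, set (T i)), (forall i, measurable (A i)) ->
    m [set x | forall i, A i (x i)] = (\prod_(i : I) mu_ i (A i))%E.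

Section Densities.
Variables (R : realType) (V : finType) (d : V -> measure_display).
Variable X : forall v, measurableType (d v).

Definition sub_space (S : {set V}) :=
  prod_space (fun i : {v : V | v \in S} => X (val i)).

Definition glue (S : {set V}) (x : prod_space X) (y : sub_space S) :
    prod_space X :=
  fun v => if @idP (v \in S) is ReflectT vS then y (exist _ v vS) else x v.

Definition depends_on (S : {set V}) (g : prod_space X -> R) : Prop :=
  forall x y : prod_space X, (forall v, v \in S -> x v = y v) -> g x = g y.

Definition potential (S : {set V}) (g : prod_space X -> R) : Prop :=
  [/\ measurable_fun [set: prod_space X] g, forall x, 0 <= g x
    & depends_on S g].

Variable mu : {measure set (prod_space X) -> \bar R}.
Variable muS : forall S : {set V}, {measure set (sub_space S) -> \bar R}.

Definition is_density (P : set (prod_space X) -> \bar R)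
    (f : prod_space X -> R) : Prop :=
  [/\ measurable_fun [set: prod_space X] f, forall x, 0 <= f x
    & forall A, measurable A -> P A = (\int[mu]_(x in A) (f x)%:E)%E].

(* The integral of g over X_S, as a function of the other coordinates of x. *)
Definition integral_over (S : {set V}) (g : prod_space X -> R)
    (x : prod_space X) : \bar R :=
  (\int[muS S]_y (g (glue x y))%:E)%E.

Definition marginal (S : {set V}) (f : prod_space X -> R) :=
  integral_over (~: S)%SET f.

(* k is a version of the conditional density f(x_tau | x_A). *)
Definition is_cond_density (f : prod_space X -> R) (tau A : {set V})
    (k : prod_space X -> R) : Prop :=
  [/\ potential (tau :|: A)%SET k,
      forall x, integral_over tau k x = 1%E
    & {ae mu, forall x,
        marginal (tau :|: A)%SET f x = ((k x)%:E * marginal A f x)%E}].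

Definition factorizes_G (G : mgraph V) (f : prod_space X -> R) : Prop :=
  exists k : {set V} -> prod_space X -> R,
  [/\ forall tau, tau \in gcomponents G ->
        is_cond_density f tau (gpa G tau) (k tau),
      {ae mu, forall x, f x = \prod_(tau in gcomponents G) k tau x}
    & forall tau, tau \in gcomponents G ->
        exists psi : {set V} -> prod_space X -> R,
          (forall h, h \in moral_cliques G tau -> potential h (psi h)) /\
          let prodpsi x := \prod_(h in moral_cliques G tau) psi h x in
          let Z := integral_over tau prodpsi in
          forall x, (0 < Z x < +oo)%E /\ k tau x = (fine (Z x))^-1 * prodpsi x].

Definition factorizes_H (E : hypergraph V) (f : prod_space X -> R) : Prop :=
  exists k : {set V} -> prod_space X -> R,
  [/\ forall tau, tau \in hcomponents E ->
        is_cond_density f tau (hpa E tau) (k tau),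
      {ae mu, forall x, f x = \prod_(tau in hcomponents E) k tau x}
    & forall tau, tau \in hcomponents E ->
        exists psi : {set V} -> prod_space X -> R,
          (forall h, h \in maxedges (hstar E tau) -> potential h (psi h)) /\
          let prodpsi x := \prod_(h in maxedges (hstar E tau)) psi h x in
          forall x, integral_over tau prodpsi x = 1%E /\ k tau x = prodpsi x].

End Densities.

(* Main.v *)
(** The chain components of the canonical DAH are those of [G], with the same
    parents, so only the clique factors of each component [tau] matter.  In a
    chain graph no arrow leaves [tau] towards its parents, hence a moral clique
    is [A :|: B] with [A] a set of parents of [tau] and [B] an undirected clique
    in [tau] every vertex of which is a child of every vertex of [A].  The sets
    [T(h) :|: H(h)] of the hyperedges attached to [tau] have this shape, and
    conversely [A :|: B] lies in the hyperedge whose head is the intersection of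
    all Phase I heads containing [B].  So the moral cliques and the maximal
    hyperedges refine each other, and potentials can be regrouped either way.
    The parents of [tau] lie in a single hyperedge, which absorbs the normalizer;
    Tonelli's theorem makes the normalizer measurable. *)
Require Import Defs.
From HB Require Import structures.
From mathcomp Require Import all_boot.

Section Combinatorics.
Set Implicit Arguments.
Unset Strict Implicit.
Unset Printing Implicit Defensive.

Variables (V : finType) (G : mgraph V).
Hypotheses (G_chain : is_chain_graph G) (G_V : verts G = [set: V]).
Implicit Types (u v w : V) (S tau A B C K : {set V}) (h : hyperedge V).

(** * Semi-directed walks, chain components and their parents *)

Let semi : rel V := fun u w => und G u w || dir G u w.

Lemma und_sym : symmetric (und G).
Proof. by case: G_chain. Qed.

Lemma connect_und_sym : connect_sym (und G).
Proof. exact/sym_connect_sym/und_sym. Qed.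

(** A semi-directed walk from [w] back to [u], shortened to distinct vertices, would close up with
    the arrow into a partially directed cycle. *)
Lemma semi_connect_dirF u w : dir G u w -> connect semi w u = false.
Proof.
case: G_chain => _ _ _ acyclic uw; apply/negP => /connectP[p pp uE].
case/shortenP: pp uE => p' pp' up' _ uE.
have cyc : cycle semi (w :: p') by rewrite /= rcons_path pp' -uE /semi uw orbT.
have up : u \in w :: p' by rewrite uE mem_last.
(* [u] is the last vertex of the cycle, so its successor is the default value of [nth], the first
   vertex [w]. *)
have := acyclic _ up' cyc u up; rewrite next_nth up uE index_last //.
by rewrite nth_default // -uE uw.
Qed.

Lemma connect_und_semi u w : connect (und G) u w -> connect semi u w.
Proof. by apply: connect_sub => a b ab; rewrite connect1 // /semi ab. Qed.

Lemma gcomponentP tau v :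
  tau \in gcomponents G -> v \in tau ->
  tau = [set u | connect (und G) v u].
Proof.
case/imsetP => w _ ->; rewrite inE => /andP[_ wv]; apply/setP => u.
rewrite !inE G_V inE /=; apply/idP/idP; last exact: connect_trans.
by apply: connect_trans; rewrite connect_und_sym.
Qed.

Lemma gcomponent_inhabited tau :
  tau \in gcomponents G -> exists v, v \in tau.
Proof. by case/imsetP => w wG ->; exists w; rewrite inE wG connect0. Qed.

Lemma gcomponent_closed tau v w :
  tau \in gcomponents G -> v \in tau -> und G v w -> w \in tau.
Proof. by move=> Gt vt vw; rewrite (gcomponentP Gt vt) inE connect1. Qed.

Lemma gcomponent_connect tau v w :
  tau \in gcomponents G -> v \in tau -> w \in tau -> connect (und G) v w.
Proof. by move=> Gt vt; rewrite (gcomponentP Gt vt) inE. Qed.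

Lemma gcomponent_dirF tau v w :
  tau \in gcomponents G -> v \in tau -> w \in tau -> dir G v w = false.
Proof.
move=> Gt vt wt; apply/negP => /semi_connect_dirF.
by rewrite (connect_und_semi (gcomponent_connect Gt wt vt)).
Qed.

(** No arrow joins two vertices of a component, so removing [tau] from the parents discards
    nothing. *)
Lemma gpaP tau u : tau \in gcomponents G ->
  reflect (exists2 v, v \in tau & dir G u v) (u \in gpa G tau).
Proof.
move=> Gt; rewrite inE; apply: (iffP andP) => [[_ /bigcupP[v vt]]|[v vt uv]].
  by rewrite inE; exists v.
split; last by apply/bigcupP; exists v; rewrite ?inE.
by apply/negP => ut; rewrite (gcomponent_dirF Gt ut vt) in uv.
Qed.

(** Lines do not leave a component, so neighbours add nothing to its boundary. *)
Lemma gbd_gcomponent tau : tau \in gcomponents G -> gbd G tau = gpa G tau.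
Proof.
move=> Gt; apply/setP => u; rewrite !inE; case: (boolP (u \in tau)) => //= ut.
apply/bigcupP/bigcupP => -[v vt]; rewrite !inE => uv; exists v; rewrite ?inE ?uv //.
case/orP: uv => // uv; case/negP: ut; apply: gcomponent_closed Gt vt _.
by rewrite und_sym.
Qed.

(** * Undirected cliques and the Phase I hyperedges *)

Definition und_clique B := {in B &, forall u w, u != w -> und G u w}.

Lemma und_cliqueS A B : A \subset B -> und_clique B -> und_clique A.
Proof. by move=> /subsetP AB cB u w /AB uB /AB wB; apply: cB. Qed.

Lemma und_clique1 v : und_clique [set v].
Proof. by move=> u w; rewrite !inE => /eqP-> /eqP->; rewrite eqxx. Qed.

Lemma und_clique_gcomponent tau B v : tau \in gcomponents G ->
  und_clique B -> v \in B -> v \in tau -> B \subset tau.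
Proof.
move=> Gt cB vB vt; apply/subsetP => w wB; case: (eqVneq v w) => [<- //|vw].
exact: gcomponent_closed Gt vt (cB _ _ vB wB vw).
Qed.

Lemma cliqueP S (e : rel V) K :
  reflect (K \subset S /\ {in K &, forall u w, u != w -> e u w}) (clique S e K).
Proof.
apply: (iffP andP) => -[KS cK]; split=> //.
  by move=> u w uK wK uw; move/forall_inP/(_ u uK)/forall_inP/(_ w wK)/implyP: cK; apply.
by apply/forall_inP => u uK; apply/forall_inP => w wK; apply/implyP; exact: cK.
Qed.

Lemma sub_maxclique S (e : rel V) B : B \subset S ->
  {in B &, forall u w, u != w -> e u w} ->
  exists2 K, K \in maxcliques S e & B \subset K.
Proof.
move=> BS cB; have /maxset_exists[K mK BK] : clique S e B by apply/cliqueP.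
by exists K; rewrite ?inE.
Qed.

Lemma maxclique_clique S (e : rel V) K : K \in maxcliques S e ->
  K \subset S /\ {in K &, forall u w, u != w -> e u w}.
Proof. by rewrite inE => /maxsetp/cliqueP. Qed.

Lemma phaseI_childrenP h : h \in phaseI_children G ->
  exists v K, [/\ h = ([set v], K), K \subset ch_v G v & und_clique K].
Proof.
case/bigcupP => v _ /imsetP[K /maxclique_clique[KS cK] ->].
by exists v, K.
Qed.

Lemma ehead_und_clique h : h \in phaseI G -> und_clique (ehead h).
Proof.
case/setUP => [/phaseI_childrenP[v [K [-> _ cK]]] //|].
by case/imsetP => K; rewrite inE => /andP[/maxclique_clique[_ cK] _] ->.
Qed.

Lemma phaseI_dir h u w :
  h \in phaseI G -> u \in etail h -> w \in ehead h -> dir G u w.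
Proof.
case/setUP => [/phaseI_childrenP[v [K [-> /subsetP KS _]]]|].
  by rewrite inE => /eqP -> /KS; rewrite inE.
by case/imsetP => K _ ->; rewrite inE.
Qed.

Lemma phaseI_parent u B : und_clique B -> {in B, forall b, dir G u b} ->
  exists2 h, h \in phaseI G & (u \in etail h) && (B \subset ehead h).
Proof.
move=> cB uB; have BS : B \subset ch_v G u.
  by apply/subsetP => b /uB; rewrite inE.
have [K mK BK] := sub_maxclique BS cB.
exists ([set u], K); last by rewrite inE eqxx.
apply/setUP; left; apply/bigcupP; exists u; first by rewrite G_V inE.
exact: imset_f.
Qed.

(** A maximal clique around [B] either is itself the head of a tailless hyperedge or lies in a head
    created from the children of some vertex. *)
Lemma phaseI_cover B : und_clique B ->
  exists2 h, h \in phaseI G & B \subset ehead h.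
Proof.
move=> cB; have BS : B \subset verts G by rewrite G_V subsetT.
have [K mK BK] := sub_maxclique BS cB.
case: (boolP [forall h in phaseI_children G, ~~ (K \subset ehead h)]) => [nK|].
  by exists (set0, K) => //; apply/setUP; right; apply: imset_f; rewrite inE mK.
case/forall_inPn => h hG; rewrite negbK => Kh; exists h; first by rewrite inE hG.
exact: subset_trans BK Kh.
Qed.

(** The head is a clique meeting [tau], so it cannot leave [tau]; every tail vertex then points to a
    vertex of [tau]. *)
Lemma phaseI_starP tau h : tau \in gcomponents G -> h \in phaseI_star G tau ->
  [/\ h \in phaseI G, ehead h \subset tau & etail h \subset gpa G tau].
Proof.
move=> Gt /setIdP[/setIdP[hG _] /set0Pn[v /setIP[vh vt]]]; have cK := ehead_und_clique hG.
split=> //; first exact: und_clique_gcomponent Gt cK vh vt.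
apply/subsetP => u uh; apply/gpaP => //; exists v => //.
exact: phaseI_dir hG uh vh.
Qed.

Lemma mem_phaseI_star tau h v : tau \in gcomponents G -> h \in phaseI G ->
  v \in ehead h -> v \in tau -> h \in phaseI_star G tau.
Proof.
move=> Gt hG vh vt; apply/setIdP; split; last first.
  by apply/set0Pn; exists v; rewrite inE vh.
apply/setIdP; split=> //; rewrite /gcl gbd_gcomponent // subUset; apply/andP; split.
  apply/subsetP => u uh; rewrite inE; apply/orP; left; apply/gpaP => //.
  by exists v => //; apply: phaseI_dir hG uh vh.
have cK := ehead_und_clique hG; rewrite subsetU //.
by rewrite (und_clique_gcomponent Gt cK vh vt) orbT.
Qed.

Lemma phaseI_star_parent tau u B : tau \in gcomponents G ->
  B \subset tau -> und_clique B -> u \in gpa G tau ->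
  {in B, forall b, dir G u b} ->
  exists2 h, h \in phaseI_star G tau & (u \in etail h) && (B \subset ehead h).
Proof.
(* A Phase I hyperedge is attached to [tau] only if its head meets [tau], so an empty [B] is
   replaced by a single child of [u] in [tau]. *)
move=> Gt; wlog [b bB] : B / exists b, b \in B => [wlogB|] Bt cB ut uB.
  case: (set_0Vmem B) => [B0|[b bB]]; last by apply: wlogB => //; exists b.
  have /gpaP[//|v vt uv] := ut.
  have [|||||h hS /andP[uh _]] := wlogB [set v]; last first.
  - by exists h; rewrite // uh B0 sub0set.
  - by move=> w /set1P->.
  - by [].
  - exact: und_clique1.
  - by rewrite sub1set.
  - by exists v; rewrite inE.
have [h hG /andP[uh Bh]] := phaseI_parent cB uB.
exists h; last by rewrite uh.
exact: mem_phaseI_star Gt hG (subsetP Bh _ bB) (subsetP Bt _ bB).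
Qed.

Lemma phaseI_star_cover tau B : tau \in gcomponents G ->
  B \subset tau -> und_clique B ->
  exists2 h, h \in phaseI_star G tau & B \subset ehead h.
Proof.
move=> Gt; wlog [b bB] : B / exists b, b \in B => [wlogB|] Bt cB.
  case: (set_0Vmem B) => [B0|[b bB]]; last by apply: wlogB => //; exists b.
  have [v vt] := gcomponent_inhabited Gt.
  have [|||h hS _] := wlogB [set v]; last by exists h; rewrite // B0 sub0set.
  - by exists v; rewrite inE.
  - by rewrite sub1set.
  - exact: und_clique1.
have [h hG Bh] := phaseI_cover cB; exists h => //.
exact: mem_phaseI_star Gt hG (subsetP Bh _ bB) (subsetP Bt _ bB).
Qed.

(** * Phase II hyperedges; components and parents of the canonical DAH *)

Definition phaseII_tail tau B : {set V} :=
  \bigcup_(h in phaseI_star G tau | B \subset ehead h) etail h.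

Lemma canonicalP h :
  reflect (exists tau B, [/\ tau \in gcomponents G, B \in phaseII_heads G tau
             & h = (phaseII_tail tau B, B)])
          (h \in canonical_DAH G).
Proof.
apply: (iffP bigcupP) => [[tau Gt /imsetP[B HB ->]]|[tau [B [Gt HB ->]]]].
  by exists tau, B.
by exists tau => //; apply: imset_f.
Qed.

Lemma phaseII_headP tau B : tau \in gcomponents G ->
  B \in phaseII_heads G tau -> B \subset tau /\ und_clique B.
Proof.
move=> Gt /imsetP[F]; rewrite inE powersetE => /andP[/subsetP FS /set0Pn[h hF]] ->.
have [hG ht _] := phaseI_starP Gt (FS _ hF).
have Fh : \bigcap_(h in F) ehead h \subset ehead h by exact: bigcap_inf.
split; first exact: subset_trans Fh ht.
exact: und_cliqueS Fh (ehead_und_clique hG).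
Qed.

Lemma ehead_phaseII_head tau h :
  h \in phaseI_star G tau -> ehead h \in phaseII_heads G tau.
Proof.
move=> hS; apply/imsetP; exists [set h]; last by rewrite big_set1.
by rewrite inE powersetE sub1set hS; apply/set0Pn; exists h; rewrite inE.
Qed.

Lemma phaseII_tail_dir tau B u b : tau \in gcomponents G ->
  u \in phaseII_tail tau B -> b \in B -> dir G u b.
Proof.
move=> Gt /bigcupP[h /andP[/(phaseI_starP Gt)[hG _ _] /subsetP Bh] uh] /Bh.
exact: phaseI_dir.
Qed.

Lemma phaseII_tail_gpa tau B :
  tau \in gcomponents G -> phaseII_tail tau B \subset gpa G tau.
Proof.
move=> Gt; apply/bigcupsP => h /andP[/(phaseI_starP Gt)[_ _ +] _].
by [].
Qed.

(** Two co-heads lie in a common clique, so they are equal or joined by a line. Conversely a line is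
    a clique of two vertices, covered by a Phase I head, which is also a Phase II head. *)
Lemma connect_cohead_canonical :
  connect (cohead (canonical_DAH G)) =2 connect (und G).
Proof.
move=> u w; apply/idP/idP; apply: connect_sub => {u w} u w.
  case/existsP => h /andP[/canonicalP[tau [B [Gt HB ->]]] /andP[uB wB]].
  have [_ cB] := phaseII_headP Gt HB.
  by case: (eqVneq u w) => [->|uw]; rewrite ?connect0 ?connect1 ?cB.
move=> uw; apply: connect1.
have Gt : [set x in verts G | connect (und G) u x] \in gcomponents G.
  by apply: imset_f; rewrite G_V inE.
set tau := (X in X \in _) in Gt.
have ut : u \in tau by rewrite inE G_V inE connect0.
have wt := gcomponent_closed Gt ut uw.
have cB : und_clique [set u; w].
  move=> a b; rewrite !inE.
  by move=> /orP[]/eqP-> /orP[]/eqP->; rewrite ?eqxx // und_sym.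
have Bt : [set u; w] \subset tau by rewrite subUset !sub1set ut.
have [h hS] := phaseI_star_cover Gt Bt cB.
rewrite subUset !sub1set => uwh; apply/existsP.
exists (phaseII_tail tau (ehead h), ehead h); rewrite /= uwh andbT.
by apply/canonicalP; exists tau, (ehead h); rewrite ehead_phaseII_head.
Qed.

Lemma hcomponents_canonical : hcomponents (canonical_DAH G) = gcomponents G.
Proof.
have compE v : [set u | connect (cohead (canonical_DAH G)) v u]
    = [set u in verts G | connect (und G) v u].
  by apply/setP => u; rewrite !in_set G_V in_setT connect_cohead_canonical.
by apply/setP => tau; apply/imsetP/imsetP => -[v _ ->]; exists v;
  rewrite ?G_V ?in_setT // compE G_V.
Qed.

(** Every tail vertex points to every head vertex. Conversely an arrow into [tau] is carried by a
    Phase I hyperedge, and Phase II keeps its head and only enlarges the tail on it. *)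
Lemma hpa_canonical tau : tau \in gcomponents G ->
  hpa (canonical_DAH G) tau = gpa G tau.
Proof.
move=> Gt; apply/setP => u; apply/idP/idP.
  rewrite inE => /andP[_ /bigcupP[v vt]]; rewrite inE => /existsP[h].
  case/andP=> /canonicalP[tau' [B [Gt' _ ->]]] /andP[uT vB].
  by apply/gpaP => //; exists v => //; apply: phaseII_tail_dir Gt' uT vB.
move=> ut; rewrite inE; have /setDP[_ ->] := ut.
have /gpaP[//|v vt uv] := ut; apply/bigcupP; exists v => //; rewrite inE.
have [||||h hS /andP[uh vh]] := @phaseI_star_parent tau u [set v] Gt.
- by rewrite sub1set.
- exact: und_clique1.
- by [].
- by move=> b /set1P->.
apply/existsP; exists (phaseII_tail tau (ehead h), ehead h) => /=.
apply/and3P; split; last by rewrite sub1set in vh.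
  by apply/canonicalP; exists tau, (ehead h); rewrite ehead_phaseII_head.
by apply/bigcupP; exists h; rewrite // hS /=.
Qed.

(** * Moral cliques against maximal hyperedges of one component *)

Section MoralGraph.
Variable tau : {set V}.
Hypothesis Gt : tau \in gcomponents G.
Let K := induced G (tau :|: gpa G tau).

Lemma verts_induced : verts K = tau :|: gpa G tau.
Proof. by rewrite /= G_V setTI. Qed.

Lemma gcomponent_induced : tau \in gcomponents K.
Proof.
have [v vt] := gcomponent_inhabited Gt; apply/imsetP; exists v.
  by rewrite verts_induced inE vt.
apply/setP => u; rewrite inE verts_induced; apply/idP/andP => [ut|[_]].
  split; first by rewrite inE ut.
  (* A walk along lines that starts in [tau] stays in [tau], so it survives in the induced graph. *)
  have /connectP[p pp ->] := gcomponent_connect Gt vt ut.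
  elim: p v vt pp => //= a p IHp v vt /andP[va pp].
  have at_ := gcomponent_closed Gt vt va.
  by apply: connect_trans (connect1 _) (IHp _ at_ pp); rewrite /= !inE vt at_.
move=> vu; rewrite (gcomponentP Gt vt) inE; apply: connect_sub vu => a b.
by case/and3P => _ _ ab; exact: connect1.
Qed.

Lemma gbd_induced : gbd K tau = gpa G tau.
Proof.
rewrite -(gbd_gcomponent Gt); apply/setP => u; rewrite !inE.
case: (boolP (u \in tau)) => //= ut.
apply/bigcupP/bigcupP => -[v vt]; rewrite !inE.
  by move=> /orP[/and3P[_ _ uv]|/and3P[_ _ uv]]; exists v => //;
     rewrite !inE uv ?orbT.
move=> uv; exists v => //.
have vt' : v \in tau :|: gpa G tau by rewrite inE vt.
suff ut' : u \in tau :|: gpa G tau.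
  by move: ut' vt'; rewrite !inE /= !inE => -> ->.
rewrite -(gbd_gcomponent Gt) !inE (negPf ut) /=.
by apply/bigcupP; exists v; rewrite ?inE.
Qed.

(** [tau] is still a component of the induced graph, with boundary [gpa G tau], so moralization
    joins its parents pairwise. *)
Lemma moral_adj_parents u w :
  u \in gpa G tau -> w \in gpa G tau -> moral_adj K u w.
Proof.
move=> ut wt; apply/or4P; constructor 4; apply/existsP; exists tau.
by rewrite gcomponent_induced gbd_induced ut.
Qed.

(** An arrow from [u] into [tau] followed by lines reaches [v]; an arrow back would close a
    cycle. *)
Lemma gpa_dirF u v : u \in gpa G tau -> v \in tau -> dir G v u = false.
Proof.
move=> /gpaP[//|w wt uw] vt; apply/negP => /semi_connect_dirF.
rewrite (connect_trans (connect1 (_ : semi u w))) ?/semi ?uw ?orbT //.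
exact: connect_und_semi (gcomponent_connect Gt wt vt).
Qed.

(* No arrow leaves [tau] towards its parents, so [tau] meets no boundary of a
   component of the induced graph: moralization adds no edge at [tau]. *)
Lemma moral_adj_gcomponent u v : v \in tau -> moral_adj K u v ->
  [\/ und G u v, dir G u v | dir G v u && (u \in tau)].
Proof.
move=> vt /or4P[/and3P[_ _ uv]|/and3P[_ _ uv]|/and3P[_ uS vu]|].
- by constructor 1.
- by constructor 2.
- case/setUP: uS => ut; first by constructor 3; rewrite vu.
  by rewrite (gpa_dirF ut vt) in vu.
case/existsP => tau' /andP[/imsetP[c cK t'E] /andP[_]].
rewrite inE => /andP[vt' /bigcupP[w wt']]; rewrite in_setU !in_set => vw.
have wS : w \in tau :|: gpa G tau by move: wt'; rewrite t'E inE verts_induced => /andP[].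
suff wt : w \in tau.
  case/negP: vt'; case/orP: vw => /and3P[_ _ vw].
    by rewrite (gcomponent_dirF Gt vt wt) in vw.
  move: wt'; rewrite t'E !inE => /andP[_ cw].
  rewrite G_V inE vt /=; apply: connect_trans cw (connect1 _).
  by rewrite /= !inE wt vt und_sym.
case/setUP: wS => // wp; case/orP: vw => /and3P[_ _ vw].
  by rewrite (gpa_dirF wp vt) in vw.
exact: gcomponent_closed Gt vt vw.
Qed.

(** Edges within [A] come from moralization, those between [A] and [B] from arrows, those within [B]
    from lines. *)
Lemma phaseII_edge_clique A B : A \subset gpa G tau -> B \subset tau ->
  und_clique B -> {in A & B, forall u b, dir G u b} ->
  exists2 C, C \in moral_cliques G tau & A :|: B \subset C.
Proof.
move=> At Bt cB AB; apply: sub_maxclique.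
  by rewrite -/K verts_induced setUC setUSS.
have S_A u : u \in A -> u \in tau :|: gpa G tau.
  by move/(subsetP At) => ut; rewrite inE ut orbT.
have S_B u : u \in B -> u \in tau :|: gpa G tau.
  by move/(subsetP Bt) => ut; rewrite inE ut.
move=> u w /setUP[uA|uB] /setUP[wA|wB] uw.
- by apply: moral_adj_parents; apply: (subsetP At).
- by apply/or4P; constructor 2; rewrite /= S_A ?S_B ?AB.
- by apply/or4P; constructor 3; rewrite /= S_A ?S_B ?AB.
- by apply/or4P; constructor 1; rewrite /= !S_B ?cB.
Qed.

Lemma maxedge_sub_clique A : A \in maxedges (hstar (canonical_DAH G) tau) ->
  exists2 C, C \in moral_cliques G tau & A \subset C.
Proof.
rewrite inE => /maxsetp/imsetP[h]; rewrite 2!inE hpa_canonical //.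
case/andP=> /andP[hE _] /andP[hT hH] ->.
(* The hyperedge may have been created by another component [tau']; the inclusions in [tau] and its
   parents come from [hstar]. *)
have /canonicalP[tau' [B [Gt' HB hEq]]] := hE; subst h.
have [Bt' cB] := phaseII_headP Gt' HB.
apply: phaseII_edge_clique => // u b uT bB.
exact: phaseII_tail_dir Gt' uT bB.
Qed.

(* The head is the intersection of all Phase I heads containing [B]; its tail
   then collects every common parent of [B]. *)
Lemma sub_maxedge A B : A \subset gpa G tau -> B \subset tau ->
  und_clique B -> {in A & B, forall u b, dir G u b} ->
  exists2 C, C \in maxedges (hstar (canonical_DAH G) tau) & A :|: B \subset C.
Proof.
move=> At Bt cB AB.
pose F := [set h in phaseI_star G tau | B \subset ehead h].
pose B' := \bigcap_(h in F) ehead h.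
have BB' : B \subset B' by apply/bigcapsP => h; rewrite inE => /andP[].
have HB' : B' \in phaseII_heads G tau.
  apply/imsetP; exists F => //; rewrite inE powersetE; apply/andP; split.
    by apply/subsetP => h; rewrite inE => /andP[].
  have [h hS Bh] := phaseI_star_cover Gt Bt cB.
  by apply/set0Pn; exists h; rewrite inE hS.
have AT : A \subset phaseII_tail tau B'.
  apply/subsetP => u uA.
  have [|h hS /andP[uh Bh]] := phaseI_star_parent Gt Bt cB (subsetP At _ uA).
    by move=> b; exact: AB.
  apply/bigcupP; exists h => //; rewrite hS /=.
  by apply: bigcap_inf; rewrite inE hS.
have [Bt' _] := phaseII_headP Gt HB'.
pose e := (phaseII_tail tau B', B').
have Tt := phaseII_tail_gpa B' Gt.
have eS : e \in hstar (canonical_DAH G) tau.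
  rewrite inE hpa_canonical //= Tt Bt' !andbT inE.
  apply/andP; split; last by rewrite setUC setUSS.
  by apply/canonicalP; exists tau, B'.
have /maxset_exists[C mC eC] : etail e :|: ehead e
    \in [set etail h :|: ehead h | h in hstar (canonical_DAH G) tau].
  exact: imset_f.
exists C; first by rewrite inE.
by apply: subset_trans eC; rewrite setUSS.
Qed.

Lemma clique_sub_maxedge C : C \in moral_cliques G tau ->
  exists2 A, A \in maxedges (hstar (canonical_DAH G) tau) & C \subset A.
Proof.
case/maxclique_clique; rewrite -/K verts_induced => CS cC.
have [||||A mA CA] := @sub_maxedge (C :&: gpa G tau) (C :&: tau).
- exact: subsetIr.
- exact: subsetIr.
- move=> u w; rewrite !inE => /andP[uC ut] /andP[wC wt] uw.
  have [//||/andP[]] := moral_adj_gcomponent wt (cC _ _ uC wC uw).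
  + by rewrite (gcomponent_dirF Gt).
  + by rewrite (gcomponent_dirF Gt).
(* A line, or an arrow from [w] to [u] inside [tau], would put the parent [u] in [tau]; only the
   arrow from [u] to [w] remains. *)
- move=> u w /setIP[uC up] /setIP[wC wt]; have /setDP[_ ut] := up.
  have uw : u != w by apply: contraNneq ut => ->.
  have [uw'|//|/andP[_]] := moral_adj_gcomponent wt (cC _ _ uC wC uw).
    by rewrite (gcomponent_closed Gt wt) // und_sym in ut.
  by rewrite (negPf ut).
exists A => //; apply: subset_trans CA.
by rewrite -setIUr subsetI subxx setUC.
Qed.

(** With an empty head the arrow condition is vacuous. This provides the hyperedge that hosts the
    inverse normalizer. *)
Lemma gpa_sub_maxedge :
  exists2 A, A \in maxedges (hstar (canonical_DAH G) tau) & gpa G tau \subset A.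
Proof.
have [||u w|u w|A mA] := @sub_maxedge (gpa G tau) set0; rewrite ?sub0set ?in_set0 //.
by rewrite setU0; exists A.
Qed.

End MoralGraph.
End Combinatorics.

From mathcomp Require Import all_order all_algebra.
From mathcomp Require Import all_classical all_reals all_analysis measurable_realfun.
Import Order.TTheory GRing.Theory Num.Theory.
Import numFieldNormedType.Exports.
Local Open Scope classical_set_scope.
Local Open Scope ring_scope.

(** * Sigma-finiteness of product measures *)

Section Analysis.
Set Implicit Arguments.
Unset Strict Implicit.
Unset Printing Implicit Defensive.

Lemma prod_lt_pinfty (R : realType) (I : Type) (r : seq I) (F : I -> \bar R) :
  (forall i, 0 <= F i < +oo)%E -> (0 <= \prod_(i <- r) F i < +oo)%E.
Proof.
move=> F0; elim/big_rec: _ => [|i x _ /andP[x0 xoo]]; first by rewrite lee01 ltry.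
have /andP[Fi0 Fioo] := F0 i; rewrite mule_ge0 //=.
by apply: lte_mul_pinfty => //; rewrite ge0_fin_numE.
Qed.

Lemma measurable_box (I : finType) (d : I -> measure_display)
    (T : forall i, measurableType (d i)) (A : forall i, set (T i)) :
  (forall i, measurable (A i)) ->
  measurable ([set x | forall i, A i (x i)] : set (prod_space T)).
Proof.
move=> mA; rewrite (_ : [set x | _]
  = \bigcap_(i in [set: I]) [set x : prod_space T | A i (x i)]); last first.
  by apply/seteqP; split=> x Ax i => [_|]; exact: Ax.
apply: fin_bigcap_measurable => // i _; apply: sub_sigma_algebra.
by exists i, (A i).
Qed.

(** Repackages a plain measure with the structure that Tonelli's theorem asks for. *)
Lemma sigma_finite_measureW d (T : measurableType d) (R : realType)
    (m : {measure set T -> \bar R}) : sigma_finite setT m ->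
  exists m' : {sigma_finite_measure set T -> \bar R}, m' = m :> (set T -> \bar R).
Proof.
move=> sf; pose sF := @isSigmaFinite.Build d T R m sf.
pose sfin := @isSFinite.Build d T R m (sfinite_measure_sigma_finite sf).
pose m' : {sigma_finite_measure set T -> \bar R} :=
  HB.pack (m : set T -> \bar R) (Measure.class m) sF sfin.
by exists m'.
Qed.

Lemma product_measure_sigma_finite (R : realType) (I : finType)
    (d : I -> measure_display) (T : forall i, measurableType (d i))
    (mu_ : forall i, {sigma_finite_measure set (T i) -> \bar R})
    (m : {measure set (prod_space T) -> \bar R}) :
  is_product_measure (fun i => mu_ i : set (T i) -> \bar R) m ->
  sigma_finite setT m.
Proof.
move=> m_prod.
have exF i : exists F : nat -> set (T i), [/\ setT = \bigcup_n F n,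
    nondecreasing_seq F & forall n, measurable (F n) /\ (mu_ i (F n) < +oo)%E].
  by apply/sigma_finiteP; exact: sigma_finiteT.
pose F i := sval (cid (exF i)); have FP i := svalP (cid (exF i)).
exists (fun n => [set x : prod_space T | forall i, F i n (x i)]).
  apply/seteqP; split=> // x _.
  have /choice[N NP] i : exists n, F i n (x i).
    have [FT _ _] := FP i; have : setT (x i) by [].
    by rewrite FT => -[n _ Fn]; exists n.
  (* The exhausting sequences are nondecreasing, so the largest index serves all coordinates at
     once. *)
  exists (\max_i N i)%N => // i; have [_ ndF _] := FP i.
  have /subsetPset := ndF _ _ (leq_bigmax i : (N i <= \max_i N i)%N).
  by apply; exact: NP.
move=> n; have mF i : measurable (F i n) by have [_ _ /(_ n)[]] := FP i.
split; first exact: (@measurable_box _ _ _ (fun i => F i n)).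
rewrite (m_prod (fun i => F i n)) //.
have /andP[] // : (0 <= \prod_i mu_ i (F i n) < +oo)%E.
by apply: prod_lt_pinfty => i; rewrite measure_ge0 /=; have [_ _ /(_ n)[]] := FP i.
Qed.

(** * Gluing of coordinates and regrouping of potentials *)

Variables (R : realType) (V : finType) (d : V -> measure_display).
Variable X : forall v : V, measurableType (d v).
Implicit Types (S : {set V}) (g : prod_space X -> R).

(** The preimage of a cylinder at [v] constrains only the second component if [v] is in [S], and
    only the first otherwise. *)
Lemma measurable_glue S :
  measurable_fun [set: prod_space X * sub_space X S]
    (fun z => Defs.glue z.1 z.2 : prod_space X).
Proof.
apply: (@measurability _ _ _ (prod_space X : measurableType _) _ _
  (cylinders (T := X))) => //.
move=> _ [_ [v [A [mA ->]]] <-]; rewrite setTI.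
have cyl1 : measurable [set x : prod_space X | A (x v)].
  by apply: sub_sigma_algebra; exists v, A.
case: (boolP (v \in S)) => vS.
  pose C : set (sub_space X S) :=
    [set y : sub_space X S | A (y (exist _ v vS))].
  have mC : measurable C by apply: sub_sigma_algebra; exists (exist _ v vS), A.
  rewrite (_ : _ @^-1` _ = [set: prod_space X * sub_space X S] `&` snd @^-1` C).
    by apply: measurable_snd.
  rewrite setTI; apply/seteqP; split=> z /=; rewrite /Defs.glue;
  by case: {-}_ / idP => // vS'; rewrite (bool_irrelevance vS' vS).
rewrite (_ : _ @^-1` _ = [set: prod_space X * sub_space X S]
   `&` fst @^-1` [set x : prod_space X | A (x v)]).
  by apply: measurable_fst.
rewrite setTI; apply/seteqP; split=> z /=; rewrite /Defs.glue;
by case: {-}_ / idP => // vS'; rewrite vS' in vS.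
Qed.

Lemma glue_in S (x x' : prod_space X) (y : sub_space X S) v :
  v \in S -> Defs.glue x y v = Defs.glue x' y v.
Proof. by rewrite /Defs.glue => vS; case: {-}_ / idP. Qed.

Lemma glue_out S (x : prod_space X) (y : sub_space X S) v :
  v \notin S -> Defs.glue x y v = x v.
Proof. by rewrite /Defs.glue => vS; case: {-}_ / idP => // vS'; rewrite vS' in vS. Qed.

Lemma potentialS S S' g : S \subset S' -> potential S g -> potential S' g.
Proof.
move=> /fintype.subsetP SS' [mg g0 dg]; split=> // x y xy; apply: dg => v vS.
exact/xy/SS'.
Qed.

Lemma potential1 S : potential S (fun _ : prod_space X => 1 : R).
Proof. by split=> //; exact: measurable_cst. Qed.

Lemma potentialM S g g' : potential S g -> potential S g' ->
  potential S (fun x => g x * g' x).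
Proof.
move=> [mg g0 dg] [mg' g0' dg']; split=> [|x|x y xy].
- exact: measurable_funM.
- exact: mulr_ge0.
- by rewrite (dg _ _ xy) (dg' _ _ xy).
Qed.

Lemma potential_prod (I : finType) (P : pred I) S (g : I -> prod_space X -> R) :
  (forall i, P i -> potential S (g i)) ->
  potential S (fun x => \prod_(i | P i) g i x).
Proof.
move=> gP; elim: (index_enum I) => [|i r IHr].
  by under eq_fun do rewrite big_nil; exact: potential1.
case Pi: (P i); under eq_fun do rewrite big_cons Pi //; last exact: IHr.
exact: potentialM (gP _ Pi) IHr.
Qed.

(** Each [A] is assigned to one chosen superset [c A] in [N], and [phi B] collects the factors
    assigned to [B]. *)
Lemma potential_regroup (M N : {set {set V}}) (psi : {set V} -> prod_space X -> R) :
  (forall A, A \in M -> exists2 B, B \in N & A \subset B) ->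
  (forall A, A \in M -> potential A (psi A)) ->
  exists phi : {set V} -> prod_space X -> R,
    (forall B, potential B (phi B)) /\
    forall x, \prod_(B in N) phi B x = \prod_(A in M) psi A x.
Proof.
move=> MN psiP; pose c (A : {set V}) : {set V} := odflt A [pick B in N | A \subset B].
have cP A : A \in M -> (c A \in N) /\ (A \subset c A).
  move=> /MN[B NB AB]; rewrite /c; case: pickP => [B' /andP[]//|/(_ B)].
  by rewrite /= NB AB.
exists (fun B x => \prod_(A in M | c A == B) psi A x); split=> [B|x].
  apply: potential_prod => A /andP[AM /eqP <-].
  exact: potentialS (cP _ AM).2 (psiP _ AM).
by rewrite [RHS](partition_big c (mem N)) // => A /cP[].
Qed.

(** * Integrating out a set of coordinates *)

Variable mu_ : forall v : V, {sigma_finite_measure set (X v) -> \bar R}.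
Variable muS : forall S, {measure set (sub_space X S) -> \bar R}.
Hypothesis muS_prod : forall S, is_product_measure
  (fun i : {v : V | v \in S} => mu_ (val i) : set (X (val i)) -> \bar R) (muS S).

(** Gluing overwrites the coordinates in [S], so only those in [A] can still matter. *)
Lemma depends_on_integral_over S A g x y :
  depends_on (S :|: A)%SET g -> (forall v, v \in A -> x v = y v) ->
  integral_over muS S g x = integral_over muS S g y.
Proof.
move=> dg xy; apply: eq_integral => z _; congr (_%:E); apply: dg => v.
case: (boolP (v \in S)) => vS; first by rewrite (glue_in x y z).
by rewrite finset.in_setU (negPf vS) => vA; rewrite !glue_out //; exact: xy.
Qed.

Lemma measurable_integral_over S g :
  measurable_fun [set: prod_space X] g -> (forall x, 0 <= g x) ->
  measurable_fun [set: prod_space X] (integral_over muS S g).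
Proof.
move=> mg g0.
have [m mE] := sigma_finite_measureW (product_measure_sigma_finite (@muS_prod S)).
rewrite (_ : integral_over muS S g
  = fubini_F m (fun z => (g (Defs.glue z.1 z.2))%:E)); last first.
  by apply/funext => x; rewrite /integral_over /fubini_F -mE.
apply: measurable_fun_fubini_tonelli_F => [|z]; last by rewrite lee_fin.
apply/measurable_EFinP; apply: (measurableT_comp mg); exact: measurable_glue.
Qed.

Lemma potential_normalizer S A g :
  potential (S :|: A)%SET g ->
  potential A (fun x => (fine (integral_over muS S g x))^-1).
Proof.
move=> [mg g0 dg].
have Z0 x : 0 <= fine (integral_over muS S g x).
  by apply: fine_ge0; apply: integral_ge0 => y _; rewrite lee_fin.
split=> [|x|x y xy].
(* Inversion is written as a real power to get its measurability; the two agree on nonnegative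
   reals, zero included. *)
- rewrite (_ : (fun x => _) = (fun x => fine (integral_over muS S g x) `^ (-1))); last first.
    by apply/funext => x; rewrite powR_inv1.
  apply: (measurableT_comp (measurable_powR _)).
  apply: (measurableT_comp (fine_measurable measurableT)).
  exact: measurable_integral_over.
- by rewrite invr_ge0.
- by rewrite (depends_on_integral_over dg xy).
Qed.

End Analysis.

Theorem theorem4 (R : realType) (V : finType) (d : V -> measure_display)
    (X : forall v : V, measurableType (d v))
    (mu_ : forall v : V, {sigma_finite_measure set (X v) -> \bar R})
    (mu : {measure set (prod_space X) -> \bar R})
    (muS : forall S : {set V}, {measure set (sub_space X S) -> \bar R})
    (mu_prod : is_product_measure (fun v => mu_ v : set (X v) -> \bar R) mu)
    (muS_prod : forall S : {set V},
       is_product_measure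
         (fun i : {v : V | v \in S} => mu_ (val i) : set (X (val i)) -> \bar R)
         (muS S))
    (G : mgraph V) (G_chain : is_chain_graph G) (G_V : verts G = [set: V]%SET)
    (P : probability (prod_space X) R) (f : prod_space X -> R)
    (f_density : is_density mu P f) :
  factorizes_G mu muS G f <-> factorizes_H mu muS (canonical_DAH G) f.
Proof.
have hE := hcomponents_canonical G_chain G_V.
have pE := hpa_canonical G_chain G_V.
have sub_moral tau C : tau \in gcomponents G -> C \in moral_cliques G tau ->
    (C \subset tau :|: gpa G tau)%SET.
  by move=> Gt /maxclique_clique[]; rewrite (verts_induced G_V).
(* The same conditional densities [k] serve on both sides, since components and parents agree; only
   the potentials change. *)
split=> -[k [k_cond fE k_fact]]; exists k; split; rewrite ?hE //.
- by move=> tau Gt; rewrite pE //; exact: k_cond.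
- move=> tau Gt; have [psi [psiP psiE]] := k_fact _ Gt.
  have [A0 mA0 pA0] := gpa_sub_maxedge G_chain G_V Gt.
  have [phi [phiP phiE]] := potential_regroup
    (fun C mC => clique_sub_maxedge G_chain G_V Gt mC) psiP.
  pose g x := \prod_(C in moral_cliques G tau) psi C x.
  pose Zinv x := (fine (integral_over muS tau g x))^-1.
  have ZinvP : potential (gpa G tau) Zinv.
    apply: (potential_normalizer muS_prod); apply: potential_prod => C mC.
    exact: potentialS (sub_moral _ _ Gt mC) (psiP _ mC).
  (* The inverse normalizer depends only on the parents of [tau], so it is charged once, to the
     maximal hyperedge [A0] containing them. *)
  exists (fun A x => (if A == A0 then Zinv x else 1) * phi A x).
  have kE x : k tau x = \prod_(A in maxedges (hstar (canonical_DAH G) tau))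
        ((if A == A0 then Zinv x else 1) * phi A x).
    rewrite big_split /= phiE (psiE x).2; congr (_ * _).
    rewrite (bigD1 A0) //= eqxx big1 ?mulr1 // => A /andP[_ /negPf->] //.
  split=> [A mA|/= x].
    apply: potentialM => //; case: eqP => [->|_]; last exact: potential1.
    exact: potentialS pA0 ZinvP.
  split; last exact: kE.
  (* The product equals [k tau], which already integrates to 1. *)
  have [_ k1 _] := k_cond _ Gt; rewrite -(k1 x); congr (integral_over _ _ _ _).
  by apply/funext => y; rewrite kE.
- by move=> tau Gt; rewrite -pE //; apply: k_cond; rewrite hE.
- by rewrite -hE.
- move=> tau Gt; have := k_fact tau; rewrite hE => /(_ Gt)[psi [psiP psiE]].
  have [phi [phiP phiE]] := potential_regroup
    (fun A mA => maxedge_sub_clique G_chain G_V Gt mA) psiP.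
  exists phi; split=> [C _|/= x]; first exact: phiP.
  have -> : (fun y => \prod_(C in moral_cliques G tau) phi C y)
    = (fun y => \prod_(A in maxedges (hstar (canonical_DAH G) tau)) psi A y).
    exact/funext.
  (* The regrouped product integrates to 1, so the normalizer is 1. *)
  by rewrite (psiE x).1 (psiE x).2 lte01 ltry invr1 mul1r.
Qed.
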